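(* Let $f:\mathbb R^n\to\mathbb R$ be convex, $\mathcal X\subseteq\mathbb R^n$ a nonempty closed convex set, $A\in\mathbb R^{m\times n}$ and $b\in\mathbb R^m$, and consider the saddle point problem of the Lagrangian $L(x,y)=f(x)-y^T(Ax-b)$ on $\mathcal X\times\mathbb R^m$ of the problem $\min\{f(x): Ax=b,\ x\in\mathcal X\}$. Let $r,s>0$. Then for every $\alpha\in[0,1]$ the generalized CP-PPA with parameters $r,s,\alpha$ coincides with the CP-PPA with parameters $r,s$ on this problem: from any given $(x^k,y^k)\in\mathbb R^n\times\mathbb R^m$, both algorithms produce the same next iterate $(x^{k+1},y^{k+1})$.
   Context: Applied to $\mathcal L=L$ with $\mathcal Y=\mathbb R^m$, the two algorithms are as follows ($\|\cdot\|$ is the Euclidean norm). CP-PPA with parameters $r,s>0$: $$x^{k+1}=\arg\min\{L(x,y^k)+\tfrac r2\|x-x^k\|^2: x\in\mathcal X\},\quad \bar x^{k+1}=2x^{k+1}-x^k,$$ $$y^{k+1}=\arg\max\{L(\bar x^{k+1},y)-\tfrac s2\|y-y^k\|^2: y\in\mathbb R^m\}.$$ Generalized CP-PPA with parameters $r,s>0$ and $\alpha\in[0,1]$: $$x^{k+1}=\arg\min\{L(x,y^k)+\tfrac r2\|x-x^k\|^2: x\in\mathcal X\},\quad \bar x^{k+1}=x^{k+1}+\alpha(x^{k+1}-x^k),$$ $$\bar y^{k+1}=\arg\max\{L(\bar x^{k+1},y)-\tfrac s2\|y-y^k\|^2: y\in\mathbb R^m\},\quad y^{k+1}=\bar y^{k+1}-(1-\alpha)\tfrac1sA(x^{k+1}-x^k).$$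 *)

(* Defs.v *)
From mathcomp Require Import all_boot all_order all_algebra.
From mathcomp Require Import boolp classical_sets interval_inference reals.
From mathcomp Require Import topology normedtype convex.

Set Implicit Arguments.
Unset Strict Implicit.
Unset Printing Implicit Defensive.

Import Order.TTheory GRing.Theory Num.Theory.
Import numFieldNormedType.Exports.

Local Open Scope classical_set_scope.
Local Open Scope ring_scope.

(* The library's norm on matrices is the sup norm, hence this definition. *)
Definition enorm (R : realType) (n : nat) (x : 'cV[R]_n) : R :=
  Num.sqrt (\sum_(i < n) x i 0 ^+ 2).

(* Sets of global minimizers and maximizers; they may be empty. *)
Definition argmin (R : realType) (T : Type) (D : set T) (g : T -> R) : set T :=
  [set x | D x /\ forall z, D z -> g x <= g z].

Definition argmax (R : realType) (T : Type) (D : set T) (g : T -> R) : set T :=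
  [set x | D x /\ forall z, D z -> g z <= g x].

Definition lagrangian (R : realType) (n m : nat) (f : 'cV[R]_n -> R)
    (A : 'M[R]_(m, n)) (b : 'cV[R]_m) (x : 'cV[R]_n) (y : 'cV[R]_m) : R :=
  f x - (y^T *m (A *m x - b)) 0 0.

(* One iteration is represented by the set of all next iterates
   (x^{k+1}, y^{k+1}) it allows from z = (x^k, y^k), so that well-definedness
   of the iteration means that this set is a singleton. *)
Definition cp_ppa_step (R : realType) (n m : nat)
    (L : 'cV[R]_n -> 'cV[R]_m -> R) (X : set 'cV[R]_n) (r s : R)
    (z : 'cV[R]_n * 'cV[R]_m) : set ('cV[R]_n * 'cV[R]_m) :=
  [set z' |
    argmin X (fun x => L x z.2 + r / 2 * enorm (x - z.1) ^+ 2) z'.1 /\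
    let xbar := 2 *: z'.1 - z.1 in
    argmax setT (fun y => L xbar y - s / 2 * enorm (y - z.2) ^+ 2) z'.2].

Definition gen_cp_ppa_step (R : realType) (n m : nat)
    (L : 'cV[R]_n -> 'cV[R]_m -> R) (X : set 'cV[R]_n) (A : 'M[R]_(m, n))
    (r s alpha : R) (z : 'cV[R]_n * 'cV[R]_m) : set ('cV[R]_n * 'cV[R]_m) :=
  [set z' |
    argmin X (fun x => L x z.2 + r / 2 * enorm (x - z.1) ^+ 2) z'.1 /\
    let xbar := z'.1 + alpha *: (z'.1 - z.1) in
    exists2 ybar : 'cV[R]_m,
      argmax setT (fun y => L xbar y - s / 2 * enorm (y - z.2) ^+ 2) ybar &
      z'.2 = ybar - (1 - alpha) *: (s^-1 *: (A *m (z'.1 - z.1)))].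

(* Main.v *)
(** Both dual steps maximize a concave quadratic, with explicit maximizer
    y^k - (A xbar - b) / s; the correction term of the generalized algorithm
    turns xbar = x + alpha (x - x^k) into 2 x - x^k, so that alpha drops out.
    What remains is that the common primal step is well defined. A finite convex
    function on R^n has at each point a minorant g a - M * sum_i |h_i|. Hence
    the proximal objective is bounded below and lower semicontinuous, and since
    it is strongly convex, its minimizing sequences on X are Cauchy and its
    minimizer is unique. *)

Require Import Defs.
From mathcomp Require Import all_boot all_order all_algebra.
From mathcomp Require Import boolp classical_sets interval_inference reals.
From mathcomp Require Import topology normedtype convex.
From mathcomp Require Import ring lra.

Set Implicit Arguments.
Unset Strict Implicit.
Unset Printing Implicit Defensive.

Import Order.TTheory GRing.Theory Num.Theory.
Import numFieldNormedType.Exports.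

Local Open Scope classical_set_scope.
Local Open Scope ring_scope.

(** * Jensen's inequality and minorants of finite convex functions *)

Definition convex_ineq (R : realType) (V : lmodType R) (g : V -> R) :=
  forall (t : R) (x y : V), 0 <= t <= 1 ->
    g (t *: x + (1 - t) *: y) <= t * g x + (1 - t) * g y.

Lemma convex_functionT (R : realType) (V : lmodType R) (g : V -> R) :
  convex_function setT g -> convex_ineq g.
Proof.
move=> g_convex t x y /andP[t0 t1].
have := g_convex (Itv01 t0 t1) x y (mem_set I) (mem_set I).
by rewrite convRE.
Qed.

Lemma convex_setZD (R : realType) (V : lmodType R) (X : set V) (t : R)
    (x y : V) :
  convex_set X -> 0 <= t <= 1 -> X x -> X y -> X (t *: x + (1 - t) *: y).
Proof.
move=> X_convex /andP[t0 t1] Xx Xy; apply/set_mem.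
exact: (X_convex x y (Itv01 t0 t1) (mem_set Xx) (mem_set Xy)).
Qed.

Lemma convex_ineq_weights (R : realType) (V : lmodType R) (g : V -> R)
    (a b : R) (x y : V) :
  convex_ineq g -> 0 < a -> 0 <= b ->
  (a + b) * g ((a + b)^-1 *: (a *: x + b *: y)) <= a * g x + b * g y.
Proof.
move=> g_convex a_gt0 b_ge0; have ab_gt0 : 0 < a + b by rewrite ltr_wpDr.
have t01 : 0 <= a / (a + b) <= 1.
  by rewrite divr_ge0 ?ler_pdivrMr ?mul1r ?lerDl//= ltW.
have tE : 1 - a / (a + b) = b / (a + b) by field; rewrite gt_eqF.
have := g_convex _ x y t01; rewrite tE -(ler_pM2l ab_gt0).
rewrite scalerDr !scalerA [_^-1 * a]mulrC [_^-1 * b]mulrC => /le_trans; apply.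
by rewrite le_eqVlt; apply/orP; left; apply/eqP; field; rewrite gt_eqF.
Qed.

(** Induction on [l]: each new point is averaged with the barycenter [W^-1 *: y] of the previous
    ones. The separate weight [w0 > 0] keeps every partial total [W] positive, so the other weights
    may vanish. *)
Lemma jensen_weights (R : realType) (V : lmodType R) (g : V -> R)
    (I : Type) (l : seq I) (w0 : R) (w : I -> R) (x0 : V) (x : I -> V) :
  convex_ineq g -> 0 < w0 -> (forall i, 0 <= w i) ->
  let W := w0 + \sum_(i <- l) w i in
  W * g (W^-1 *: (w0 *: x0 + \sum_(i <- l) w i *: x i)) <=
  w0 * g x0 + \sum_(i <- l) w i * g (x i).
Proof.
move=> g_convex w0_gt0 w_ge0 /=; elim: l => [|i l IHl].
  by rewrite !big_nil !addr0 scalerA mulVf ?scale1r// gt_eqF.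
rewrite !big_cons.
set W := w0 + \sum_(i <- l) w i in IHl *.
set y := w0 *: x0 + \sum_(i <- l) w i *: x i in IHl *.
have W_gt0 : 0 < W by rewrite ltr_wpDr ?sumr_ge0.
have := convex_ineq_weights (W^-1 *: y) (x i) g_convex W_gt0 (w_ge0 i).
rewrite scalerA divff ?gt_eqF// scale1r.
rewrite addrCA [w i + _]addrC [w0 *: x0 + _]addrCA [w i *: x i + _]addrC -/W -/y.
by move=> /le_trans; apply; rewrite addrCA [leRHS]addrC lerD2r.
Qed.

(* With S the sum of the |h i 0|, the point a is the barycenter of a + h, of
   weight 1 / (1 + S), and of the a - sgr (h i 0) *: e_i, of weights
   |h i 0| / (1 + S). *)
Lemma convex_lower_bound (R : realType) (n : nat) (g : 'cV[R]_n -> R)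
    (a : 'cV[R]_n) :
  convex_ineq g ->
  exists2 M : R, 0 <= M &
    forall h : 'cV[R]_n, g a - M * \sum_i `|h i 0| <= g (a + h).
Proof.
move=> g_convex.
pose e i : 'cV[R]_n := delta_mx i 0.
pose N i : R := `|g (a - e i) - g a| + `|g (a + e i) - g a|.
have N_ge0 i : 0 <= N i by rewrite addr_ge0.
exists (\sum_i N i) => [|h]; first exact: sumr_ge0.
(* According to the sign, the point is [a - e i], [a] or [a + e i]; [N i] covers all three cases. *)
have Ng i : g (a - Num.sg (h i 0) *: e i) <= g a + \sum_i N i.
  have : N i <= \sum_i N i by rewrite (bigD1 i)//= lerDl sumr_ge0.
  have := ler_norm (g (a - e i) - g a); have := ler_norm (g (a + e i) - g a).
  have := normr_ge0 (g (a - e i) - g a).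
  have := normr_ge0 (g (a + e i) - g a).
  rewrite {1}/N; case: sgrP => _;
    by rewrite ?scale0r ?scaleN1r ?scale1r ?subr0 ?opprK; lra.
have := jensen_weights (index_enum 'I_n) (a + h)
  (fun i => a - Num.sg (h i 0) *: e i) g_convex ltr01
  (fun i => normr_ge0 (h i 0)).
set S : R := \sum_i `|h i 0|.
have S_ge0 : 0 <= S by exact: sumr_ge0.
have -> : 1 *: (a + h) + \sum_i `|h i 0| *: (a - Num.sg (h i 0) *: e i) =
    (1 + S) *: a.
  apply/colP => k; rewrite !mxE summxE.
  rewrite (eq_bigr (fun i => `|h i 0| * a k 0 - h i 0 * (i == k)%:R)); last first.
    move=> i _; rewrite !mxE eqxx andbT [k == i]eq_sym [X in _ = _ - X * _]numEsg; ring.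
  rewrite sumrB -mulr_suml -/S [X in _ - X](bigD1 k)//= eqxx big1; last first.
    by move=> i ik; rewrite (negPf ik) mulr0.
  by rewrite mulr1; ring.
rewrite /= scalerA mulVf ?scale1r ?gt_eqF ?ltr_wpDr// mul1r.
(* With this bound Jensen becomes [(1 + S) * g a <= g (a + h) + S * (g a + \sum_i N i)], and
   [S * g a] cancels. *)
have : \sum_i `|h i 0| * g (a - Num.sg (h i 0) *: e i) <=
    S * (g a + \sum_i N i).
  by rewrite mulr_suml ler_sum// => i _; rewrite ler_wpM2l.
lra.
Qed.

(** * Euclidean norm and the proximal minimization *)

Lemma sqr_enorm (R : realType) (n : nat) (x : 'cV[R]_n) :
  enorm x ^+ 2 = \sum_i x i 0 ^+ 2.
Proof. by rewrite sqr_sqrtr// sumr_ge0// => i _; rewrite sqr_ge0. Qed.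

Lemma sqr_enorm_le0 (R : realType) (n : nat) (x : 'cV[R]_n) :
  enorm x ^+ 2 <= 0 -> x = 0.
Proof.
rewrite sqr_enorm => x_le0; apply/colP => i; rewrite mxE; apply/eqP.
rewrite -sqrf_eq0 eq_le sqr_ge0 andbT (le_trans _ x_le0)//.
by rewrite (bigD1 i)//= lerDl sumr_ge0// => j _; rewrite sqr_ge0.
Qed.

Lemma sqr_enorm_conv (R : realType) (n : nat) (t : R) (x y : 'cV[R]_n) :
  enorm (t *: x + (1 - t) *: y) ^+ 2 =
  t * enorm x ^+ 2 + (1 - t) * enorm y ^+ 2 - t * (1 - t) * enorm (x - y) ^+ 2.
Proof.
rewrite !sqr_enorm !mulr_sumr -big_split/= -sumrB.
by apply: eq_bigr => i _; rewrite !mxE; ring.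
Qed.

Definition prox_objective (R : realType) (n : nat) (g : 'cV[R]_n -> R)
    (r : R) (x0 x : 'cV[R]_n) : R := g x + r / 2 * enorm (x - x0) ^+ 2.

Lemma prox_objective_conv (R : realType) (n : nat) (g : 'cV[R]_n -> R)
    (r t : R) (x0 x y : 'cV[R]_n) :
  convex_ineq g -> 0 <= t <= 1 ->
  prox_objective g r x0 (t *: x + (1 - t) *: y) <=
  t * prox_objective g r x0 x + (1 - t) * prox_objective g r x0 y -
  r / 2 * (t * (1 - t)) * enorm (x - y) ^+ 2.
Proof.
move=> g_convex t01; have := g_convex t x y t01; rewrite /prox_objective.
have -> : t *: x + (1 - t) *: y - x0 = t *: (x - x0) + (1 - t) *: (y - x0).
  by apply/colP => i; rewrite !mxE; ring.
rewrite sqr_enorm_conv opprB addrA subrK; nra.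
Qed.

(** The quadratic term dominates the linear decrease of the minorant at [x0]: completing the square
    in each coordinate gives [M * z - r / 2 * z ^+ 2 <= M ^+ 2 / (2 * r)]. *)
Lemma prox_objective_lbound (R : realType) (n : nat) (g : 'cV[R]_n -> R)
    (r : R) (x0 : 'cV[R]_n) :
  convex_ineq g -> 0 < r -> exists c, forall x, c <= prox_objective g r x0 x.
Proof.
move=> g_convex r_gt0; have [M M_ge0 gM] := convex_lower_bound x0 g_convex.
exists (g x0 - \sum_(i < n) M ^+ 2 / (2 * r)) => x.
have := gM (x - x0); rewrite (addrC x0) subrK /prox_objective sqr_enorm.
suff : M * (\sum_i `|(x - x0) i 0|) - \sum_(i < n) M ^+ 2 / (2 * r) <=
    r / 2 * \sum_i (x - x0) i 0 ^+ 2 by lra.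
rewrite !mulr_sumr -sumrB ler_sum// => i _.
rewrite -[_ ^+ 2 in leRHS]real_normK ?num_real//.
set z := `|_|; rewrite -subr_ge0.
have -> : r / 2 * z ^+ 2 - (M * z - M ^+ 2 / (2 * r)) =
    (r * z - M) ^+ 2 / (2 * r) by field; rewrite gt_eqF.
by rewrite divr_ge0 ?sqr_ge0// mulr_ge0// ltW.
Qed.

Lemma argmin_prox (R : realType) (n : nat) (g : 'cV[R]_n -> R)
    (X : set 'cV[R]_n) (r : R) (x0 : 'cV[R]_n) :
  convex_ineq g -> X !=set0 -> closed X -> convex_set X -> 0 < r ->
  exists x, argmin X (prox_objective g r x0) = [set x].
Proof.
move=> g_convex [p0 Xp0] X_closed X_convex r_gt0.
set phi := prox_objective g r x0.
have half01 : 0 <= (2^-1 : R) <= 1 by apply/andP; split; lra.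
(* Strong convexity at the midpoint, where [phi] is still at least [m]; the factor is
   [r / 8 = r / 2 * (1 / 4)]. It serves both the Cauchy property and uniqueness. *)
have phi_mid m x y : (forall z, X z -> m <= phi z) -> X x -> X y ->
    r / 8 * enorm (x - y) ^+ 2 <= (phi x - m) / 2 + (phi y - m) / 2.
  move=> m_le Xx Xy.
  have := m_le _ (convex_setZD X_convex half01 Xx Xy).
  have := prox_objective_conv r x0 x y g_convex half01; rewrite -/phi; lra.
have [c phi_ge] := prox_objective_lbound x0 g_convex r_gt0.
pose m := inf (phi @` X).
have phi_inf : has_inf (phi @` X).
  by split; [exists (phi p0), p0|exists c => _ [x _ <-]; exact: phi_ge].
have m_le z : X z -> m <= phi z.
  by move=> Xz; apply: (ge_inf phi_inf.2); exists z.
have /choice[u u_min] : forall k : nat, exists x, X x /\ phi x < m + k.+1%:R^-1.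
  move=> k; have k_gt0 : 0 < k.+1%:R^-1 :> R by rewrite invr_gt0.
  by have [_ [x Xx <-] ?] := inf_adherent k_gt0 phi_inf; exists x.
have Xu k : X (u k) by have [] := u_min k.
have phi_u e : 0 < e -> \forall k \near \oo, phi (u k) < m + e.
  move=> e_gt0; near=> k; apply: (lt_trans (u_min k).2); rewrite ltrD2l.
  near: k; exact: (near_infty_natSinv_lt (PosNum e_gt0)).
have cvg_u : cvg (u @ \oo).
  apply: cauchy_cvg; apply: cauchy_exP => e e_gt0.
  (* If both values are below [m + d] for this [d], then [phi_mid] bounds the squared distance
     strictly by [e ^+ 2]. *)
  have d_gt0 : 0 < e ^+ 2 * r / 8 by rewrite !mulr_gt0 ?exprn_gt0.
  have [N _ N_min] := phi_u _ d_gt0.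
  exists (u N); exists N => // k Nk; split=> // i j.
  (* Balls of matrices are entrywise, and each squared entry is at most the squared Euclidean
     norm. *)
  rewrite (ord1 j) /ball/= -(ltr_pXn2r (n := 2)) ?nnegrE// ?ltW//.
  rewrite real_normK ?num_real//.
  apply: (@le_lt_trans _ _ (enorm (u N - u k) ^+ 2)).
    rewrite sqr_enorm (bigD1 i)//= !mxE lerDl sumr_ge0// => l _; exact: sqr_ge0.
  have := phi_mid _ _ _ m_le (Xu N) (Xu k).
  have := N_min N (leqnn N); have := N_min k Nk; rewrite /= => ? ? ?.
  rewrite -(ltr_pM2l r_gt0); lra.
have /cvg_ex[x ux] := cvg_u.
have Xx : X x by apply: (closed_cvg X X_closed _ x ux); apply: nearW.
have phi_convex : convex_ineq phi.
  move=> t y z t01; apply: (le_trans (prox_objective_conv _ _ _ _ g_convex t01)).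
  have /andP[t_ge0 t_le1] := t01.
  rewrite lerBlDr lerDl mulr_ge0 ?sqr_ge0// mulr_ge0//.
    by rewrite divr_ge0 ?ltW.
  by rewrite mulr_ge0 ?subr_ge0.
(* Lower semicontinuity at the limit [x]: the minorant of [phi] centred at [x] bounds [phi x] by
   [phi (u k)] plus a multiple of the entrywise distance. *)
have [M M_ge0 phiM] := convex_lower_bound x phi_convex.
have phix : phi x <= m.
  apply/ler_addgt0Pr => e e_gt0.
  (* The [n] entries of [u k - x] together contribute at most [e / 2]; the [+ 1] keeps the radius
     defined when [M * n%:R] is zero. *)
  have D_gt0 : 0 < M * n%:R + 1 by rewrite ltr_wpDl// mulr_ge0.
  have d_gt0 : 0 < e / 2 / (M * n%:R + 1) by rewrite !divr_gt0.
  have e2_gt0 : 0 < e / 2 by rewrite divr_gt0.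
  have [k /= [uk xuk]] : exists k, phi (u k) < m + e / 2 /\
      ball x (e / 2 / (M * n%:R + 1)) (u k).
    exact: filter_ex (filterI (phi_u _ e2_gt0) (cvg_ball ux d_gt0)).
  have := phiM (u k - x); rewrite (addrC x) subrK.
  have : M * \sum_i `|(u k - x) i 0| <= e / 2.
    apply: (@le_trans _ _ (M * \sum_(i < n) (e / 2 / (M * n%:R + 1)))).
      rewrite ler_wpM2l// ler_sum// => i _.
      by have [_ /(_ i 0)] := xuk; rewrite /ball/= !mxE distrC => /ltW.
    rewrite sumr_const card_ord -[X in M * X]mulr_natr.
    rewrite [leLHS](_ : _ = e / 2 * (M * n%:R / (M * n%:R + 1))); last by ring.
    by rewrite ler_piMr ?ltW// ltr_pdivrMr// mul1r ltrDl.
  lra.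
exists x; apply/seteqP; split => [y [Xy y_min]|_ ->] /=; last first.
  by split=> // z Xz; exact: le_trans (m_le z Xz).
(* Both values are at most the infimum [m], so [phi_mid] forces the distance to vanish. *)
have := phi_mid _ _ _ m_le Xy Xx; have := y_min x Xx.
have := sqr_ge0 (enorm (y - x)).
move=> q_ge0 yx q_le.
apply/eqP; rewrite -subr_eq0; apply/eqP/sqr_enorm_le0.
rewrite -(ler_pM2l (_ : 0 < r / 8)) ?divr_gt0// mulr0; lra.
Unshelve. all: by end_near.
Qed.

(** * The dual step *)

Lemma argmax_quadratic (R : realType) (m : nat) (g : 'cV[R]_m -> R)
    (c s : R) (y0 : 'cV[R]_m) :
  0 < s -> (forall y, g y = c - s * enorm (y - y0) ^+ 2) ->
  argmax setT g = [set y0].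
Proof.
move=> s_gt0 gE; have g0 : g y0 = c.
  by rewrite gE sqr_enorm big1 ?mulr0 ?subr0// => i _; rewrite subrr mxE expr0n.
apply/seteqP; split => [y [_ y_max]|_ ->] /=; last first.
  split=> // z _; rewrite g0 gE gerBl mulr_ge0 ?sqr_ge0// ltW//.
apply/eqP; rewrite -subr_eq0; apply/eqP/sqr_enorm_le0.
rewrite -(pmulr_rle0 _ s_gt0); have := y_max y0 I; rewrite g0 gE; lra.
Qed.

(** Completing the square in [y]; the constant passed to [argmax_quadratic] is the value at the
    maximizer [y0 - s^-1 *: d]. *)
Lemma argmax_lagrangian (R : realType) (n m : nat) (f : 'cV[R]_n -> R)
    (A : 'M[R]_(m, n)) (b : 'cV[R]_m) (s : R) (x : 'cV[R]_n) (y0 : 'cV[R]_m) :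
  0 < s ->
  argmax setT (fun y => lagrangian f A b x y - s / 2 * enorm (y - y0) ^+ 2) =
  [set y0 - s^-1 *: (A *m x - b)].
Proof.
move=> s_gt0; set d := A *m x - b.
apply: (@argmax_quadratic _ _ _
  (f x - \sum_i (y0 i 0 * d i 0 - d i 0 ^+ 2 / (2 * s))) (s / 2)) => [|y].
  by rewrite divr_gt0.
rewrite /lagrangian -/d !mxE !sqr_enorm -!addrA -!opprD; congr (_ - _).
rewrite !mulr_sumr -!big_split/=; apply: eq_bigr => i _.
by rewrite !mxE; field; rewrite gt_eqF.
Qed.

Lemma convex_lagrangian (R : realType) (n m : nat) (f : 'cV[R]_n -> R)
    (A : 'M[R]_(m, n)) (b y : 'cV[R]_m) :
  convex_ineq f -> convex_ineq (fun x => lagrangian f A b x y).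
Proof.
move=> f_convex t x z t01; have := f_convex t x z t01; rewrite /lagrangian.
have -> : A *m (t *: x + (1 - t) *: z) - b =
    t *: (A *m x - b) + (1 - t) *: (A *m z - b).
  rewrite mulmxDr -!scalemxAr.
  by apply/colP => i; rewrite !mxE; ring.
move: (A *m x - b) (A *m z - b) => u v.
have -> : (y^T *m (t *: u + (1 - t) *: v)) 0 0 =
    t * (y^T *m u) 0 0 + (1 - t) * (y^T *m v) 0 0.
  by rewrite mulmxDr -!scalemxAr [LHS]mxE; congr (_ + _); rewrite [LHS]mxE.
lra.
Qed.

Theorem mainTheorem3 (R : realType) (n m : nat)
    (f : 'cV[R]_n -> R) (X : set 'cV[R]_n)
    (A : 'M[R]_(m, n)) (b : 'cV[R]_m) (r s : R)
    (f_convex : convex_function setT f)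
    (X_nonempty : X !=set0) (X_closed : closed X) (X_convex : convex_set X)
    (r_gt0 : 0 < r) (s_gt0 : 0 < s) :
  forall alpha : R, 0 <= alpha <= 1 ->
  forall (xk : 'cV[R]_n) (yk : 'cV[R]_m),
  exists z : 'cV[R]_n * 'cV[R]_m,
    cp_ppa_step (lagrangian f A b) X r s (xk, yk) = [set z] /\
    gen_cp_ppa_step (lagrangian f A b) X A r s alpha (xk, yk) = [set z].
Proof.
move=> alpha _ xk yk.
have L_convex := convex_lagrangian A b yk (convex_functionT f_convex).
have [x x_min] := argmin_prox xk L_convex X_nonempty X_closed X_convex r_gt0.
rewrite /prox_objective in x_min.
exists (x, yk - s^-1 *: (A *m (2 *: x - xk) - b)).
rewrite /cp_ppa_step /gen_cp_ppa_step /= x_min; split.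
  apply/seteqP; split => [[x' y'] /= [->]|_ ->] /=.
    by rewrite argmax_lagrangian// => ->.
  by rewrite argmax_lagrangian.
(* The multiples [alpha] and [1 - alpha] of [s^-1 *: (A *m (x - xk))] add up to a full one. *)
have yE : yk - s^-1 *: (A *m (x + alpha *: (x - xk)) - b) -
    (1 - alpha) *: (s^-1 *: (A *m (x - xk))) =
    yk - s^-1 *: (A *m (2 *: x - xk) - b).
  rewrite !(mulmxDr, mulmxN, =^~ scalemxAr).
  by apply/colP => i; rewrite !mxE; ring.
apply/seteqP; split => [[x' y'] /= [-> [ybar]]|_ ->] /=.
  by rewrite argmax_lagrangian// => -> ->; rewrite yE.
rewrite argmax_lagrangian//; split=> //.
by eexists; [reflexivity|rewrite yE].
Qed.
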